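(* Let $c$ be a non-probabilistic hpgcl program (one containing no probabilistic choice $\{c_1\}[p]\{c_2\}$). Then for all classical separation logic formulas $\varphi,\psi$: the Hoare triple $\{\varphi\}\,c\,\{\psi\}$ is valid for total correctness if and only if $\underline{\varphi}\preceq\mathrm{wp}[c](\underline{\psi})$.
   Context: Programs of hpgcl: $c::=\mathtt{skip}\mid x:=e\mid c;c\mid\mathtt{if}\,(b)\,\{c\}\,\mathtt{else}\,\{c\}\mid\mathtt{while}\,(b)\,\{c\}\mid\{c\}\,[p]\,\{c\}\mid x:=\mathtt{new}(e_1,\dots,e_n)\mid\langle e\rangle:=e'\mid x:=\langle e\rangle\mid\mathtt{free}(e)$, with $x$ a variable, $e,e',e_i$ arithmetic expressions over variables, $b$ a Boolean guard over variables. $\mathtt{new}$ allocates a fresh block at a nondeterministically chosen address $u\in\mathbb{N}_{>0}$ with $u,\dots,u+n-1$ unallocated, stores $s(e_1),\dots,s(e_n)$ there and sets $x:=u$; $\langle e\rangle:=e'$, $x:=\langle e\rangle$, $\mathtt{free}(e)$ respectively write, read and deallocate address $s(e)$ and cause a memory fault if $s(e)$ is not allocated. States are pairs $(s,h)$ of a stack $s:\mathrm{Vars}\to\mathbb{Z}$ and a heap $h:N\to\mathbb{Z}$, $N=\mathrm{dom}(h)\subseteq\mathbb{N}_{>0}$ finite; $s(e)$ is the value of $e$; heaps are disjoint ($\perp$) if their domains are and $h_1\star h_2$ is their union. The triple $\{\varphi\}c\{\psi\}$ is valid for total correctness iff for every state satisfying $\varphi$, every execution of $c$ (for every resolution of allocation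 nondeterminism) terminates without memory fault and its final state satisfies $\psi$. $\mathbb{E}_{\le1}$ is the set of functions $\Sigma\to[0,1]$ ordered pointwise by $\preceq$; all infima are taken in $[0,1]$ (so $\inf\emptyset=1$); $[\varphi]$ is the indicator of $\varphi$. $(X\star Y)(s,h)=\max\{X(s,h_1)Y(s,h_2)\mid h=h_1\star h_2\}$; $(Y\mathbin{-\!\!\star}X)(s,h)=\inf\{X(s,h\star h')/Y(s,h')\mid h'\perp h,\ Y(s,h')>0\}$ (for $\{0,1\}$-valued $Y=[\varphi]$ this is $\inf\{X(s,h\star h')\mid h'\perp h,(s,h')\models\varphi\}$). $[e\mapsto e_1,\dots,e_n](s,h)=1$ iff $\mathrm{dom}(h)=\{s(e),\dots,s(e)+n-1\}$ and $h(s(e)+i-1)=s(e_i)$; $[e\mapsto -](s,h)=1$ iff $\mathrm{dom}(h)=\{s(e)\}$; $X[x/e]=\lambda(s,h).X(s[x\mapsto s(e)],h)$. Classical SL formulas: built from atomic formulas ($\mathsf{emp}$, $e\mapsto e'$, $e\mapsto-$, pure comparisons, etc.) by $\neg,\wedge,\exists x,\star,\mathbin{-\!\!\star}$ with standard semantics. Embedding into $\mathbb{E}_{\le1}$: $\underline{\varphi}=[\varphi]$ for atomic $\varphi$; $\underline{\neg\varphi}=1-\underline{\varphi}$; $\underline{\varphi_1\star\varphi_2}=\underline{\varphi_1}\star\underline{\varphi_2}$; $\underline{\varphi_1\mathbin{-\!\!\star}\varphi_2}=\underline{\varphi_1}\mathbin{-\!\!\star}\underline{\varphi_2}$; $\underline{\exists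 x\colon\varphi}=\sup_{v\in\mathbb{Z}}\underline{\varphi}[x/v]$; $\underline{\varphi_1\wedge\varphi_2}=\underline{\varphi_1}\cdot\underline{\varphi_2}$. $\mathrm{wp}[c]:\mathbb{E}_{\le1}\to\mathbb{E}_{\le1}$: $\mathrm{wp}[\mathtt{skip}](X)=X$; $\mathrm{wp}[x:=e](X)=X[x/e]$; $\mathrm{wp}[c_1;c_2](X)=\mathrm{wp}[c_1](\mathrm{wp}[c_2](X))$; $\mathrm{wp}[\mathtt{if}\,(b)\,\{c_1\}\,\mathtt{else}\,\{c_2\}](X)=[b]\cdot\mathrm{wp}[c_1](X)+[\neg b]\cdot\mathrm{wp}[c_2](X)$; $\mathrm{wp}[\mathtt{while}\,(b)\,\{c'\}](X)=\mathrm{lfp}\,Y.\,[\neg b]\cdot X+[b]\cdot\mathrm{wp}[c'](Y)$; $\mathrm{wp}[x:=\mathtt{new}(e_1,\dots,e_n)](X)(s,h)=\inf\{([v\mapsto e_1,\dots,e_n]\mathbin{-\!\!\star}X[x/v])(s,h)\mid v\in\mathbb{N}_{>0},\ v,\dots,v+n-1\notin\mathrm{dom}(h)\}$; $\mathrm{wp}[x:=\langle e\rangle](X)=\sup_{v\in\mathbb{Z}}[e\mapsto v]\star([e\mapsto v]\mathbin{-\!\!\star}X[x/v])$; $\mathrm{wp}[\langle e\rangle:=e'](X)=[e\mapsto -]\star([e\mapsto e']\mathbin{-\!\!\star}X)$; $\mathrm{wp}[\mathtt{free}(e)](X)=[e\mapsto -]\star X$. *)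

(* Defs.v *)
From Stdlib Require Import Relations.
From HB Require Import structures.
From mathcomp Require Import all_boot all_order all_algebra finmap.
From mathcomp Require Import boolp classical_sets reals interval_inference.

Set Implicit Arguments.
Unset Strict Implicit.
Unset Printing Implicit Defensive.

Import Order.TTheory GRing.Theory Num.Theory.
Local Open Scope ring_scope.
Local Open Scope classical_set_scope.

Record addr := Addr { addr_val :> nat; _ : (0 < addr_val)%N }.
HB.instance Definition _ := [isSub for addr_val].
HB.instance Definition _ := [Choice of addr by <:].

Definition addr_of_int (z : int) : option addr :=
  if z is Posz n then insub n else None.

Fact shift_subproof (u : addr) (i : nat) : (0 < u + i)%N.
Proof. by case: u => u u_gt0 /=; rewrite addn_gt0 u_gt0. Qed.

Definition shift (u : addr) (i : nat) : addr := Addr (shift_subproof u i).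

Definition heap := {fmap addr -> int}.

Definition hdisj (h1 h2 : heap) : bool := fdisjoint (domf h1) (domf h2).

(* Only used on disjoint heaps, where the bias of [catf] is irrelevant. *)
Definition hunion (h1 h2 : heap) : heap := catf h1 h2.

(* The content of the heap at an arbitrary integer; [None] if the integer is
   not an allocated address (in particular if it is not positive). *)
Definition lookup (h : heap) (z : int) : option int :=
  obind (fun a : addr => h.[? a]%fmap) (addr_of_int z).

Definition stores (h : heap) (u : addr) (vs : seq int) : heap :=
  foldr (fun i (h' : heap) => h'.[shift u i <- nth 0 vs i]%fmap)
        h (iota 0 (size vs)).

Definition fresh (h : heap) (u : addr) (n : nat) : Prop :=
  forall i, (i < n)%N -> shift u i \notin domf h.

Section Syntax.
Variable V : eqType.

Definition stack := V -> int.
Definition state : Type := (stack * heap)%type.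

Definition upd (s : stack) (x : V) (v : int) : stack :=
  fun y => if y == x then v else s y.

(* The arithmetic operators and the comparisons are not fixed: any function
   on the integers may occur. *)
Inductive aexpr : Type :=
| EConst of int
| EVar of V
| EOp of (int -> int -> int) & aexpr & aexpr.

Inductive bexpr : Type :=
| BConst of bool
| BCmp of rel int & aexpr & aexpr
| BNot of bexpr
| BAnd of bexpr & bexpr.

Fixpoint aeval (s : stack) (e : aexpr) : int :=
  match e with
  | EConst z => z
  | EVar x => s x
  | EOp op e1 e2 => op (aeval s e1) (aeval s e2)
  end.

Fixpoint beval (s : stack) (b : bexpr) : bool :=
  match b with
  | BConst t => t
  | BCmp r e1 e2 => r (aeval s e1) (aeval s e2)
  | BNot b1 => ~~ beval s b1
  | BAnd b1 b2 => beval s b1 && beval s b2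
  end.

(* [APred P es] is a predicate symbol with interpretation [P] applied to
   [es]; it stands for whatever further atoms (list segments, ...) one wants. *)
Inductive atom : Type :=
| AEmp
| APto of aexpr & seq aexpr
| AAlloc of aexpr
| APure of bexpr
| APred of (seq int -> heap -> Prop) & seq aexpr.

Inductive formula : Type :=
| FAtom of atom
| FNot of formula
| FAnd of formula & formula
| FEx of V & formula
| FStar of formula & formula
| FWand of formula & formula.

Definition points_to (e : aexpr) (es : seq aexpr) (sg : state) : Prop :=
  let: (s, h) := sg in
  (forall z : int, lookup h z <> None <->
     exists2 i, (i < size es)%N & z = aeval s e + i%:Z) /\
  (forall i, (i < size es)%N ->
     lookup h (aeval s e + i%:Z) = Some (aeval s (nth (EConst 0) es i))).

Definition points_to_any (e : aexpr) (sg : state) : Prop :=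
  let: (s, h) := sg in
  forall z : int, lookup h z <> None <-> z = aeval s e.

Definition sat_atom (a : atom) (sg : state) : Prop :=
  match a with
  | AEmp => domf sg.2 = fset0
  | APto e es => points_to e es sg
  | AAlloc e => points_to_any e sg
  | APure b => beval sg.1 b
  | APred P es => P [seq aeval sg.1 e | e <- es] sg.2
  end.

Fixpoint sat (phi : formula) (sg : state) : Prop :=
  let: (s, h) := sg in
  match phi with
  | FAtom a => sat_atom a sg
  | FNot f => ~ sat f sg
  | FAnd f g => sat f sg /\ sat g sg
  | FEx x f => exists v : int, sat f (upd s x v, h)
  | FStar f g => exists h1 h2 : heap,
      [/\ hdisj h1 h2, h = hunion h1 h2, sat f (s, h1) & sat g (s, h2)]
  | FWand f g => forall h' : heap,
      hdisj h h' -> sat f (s, h') -> sat g (s, hunion h h')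
  end.

Variable R : realType.

Inductive prog : Type :=
| Skip
| Assign of V & aexpr
| Seq of prog & prog
| If of bexpr & prog & prog
| While of bexpr & prog
| PChoice of prog & {i01 R} & prog
| New of V & seq aexpr
| Store of aexpr & aexpr
| Fetch of V & aexpr
| Free of aexpr.

Fixpoint nonprobabilistic (c : prog) : bool :=
  match c with
  | Seq c1 c2 | If _ c1 c2 => nonprobabilistic c1 && nonprobabilistic c2
  | While _ c1 => nonprobabilistic c1
  | PChoice _ _ _ => false
  | _ => true
  end.

Inductive config : Type :=
| Run of prog & state
| Term of state
| Fault.

(* The branches of a probabilistic choice are the possible (i.e. positive
   probability) transitions. *)
Inductive step : config -> config -> Prop :=
| step_skip s h : step (Run Skip (s, h)) (Term (s, h))
| step_assign x e s h :
    step (Run (Assign x e) (s, h)) (Term (upd s x (aeval s e), h))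
| step_seq_run c1 c1' c2 sg sg' :
    step (Run c1 sg) (Run c1' sg') ->
    step (Run (Seq c1 c2) sg) (Run (Seq c1' c2) sg')
| step_seq_term c1 c2 sg sg' :
    step (Run c1 sg) (Term sg') -> step (Run (Seq c1 c2) sg) (Run c2 sg')
| step_seq_fault c1 c2 sg :
    step (Run c1 sg) Fault -> step (Run (Seq c1 c2) sg) Fault
| step_if_true b c1 c2 s h :
    beval s b -> step (Run (If b c1 c2) (s, h)) (Run c1 (s, h))
| step_if_false b c1 c2 s h :
    ~~ beval s b -> step (Run (If b c1 c2) (s, h)) (Run c2 (s, h))
| step_while_true b c s h :
    beval s b ->
    step (Run (While b c) (s, h)) (Run (Seq c (While b c)) (s, h))
| step_while_false b c s h :
    ~~ beval s b -> step (Run (While b c) (s, h)) (Term (s, h))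
| step_choice_left c1 p c2 sg :
    0 < p%:num -> step (Run (PChoice c1 p c2) sg) (Run c1 sg)
| step_choice_right c1 p c2 sg :
    p%:num < 1 -> step (Run (PChoice c1 p c2) sg) (Run c2 sg)
| step_new x es s h (u : addr) :
    fresh h u (size es) ->
    step (Run (New x es) (s, h))
         (Term (upd s x (addr_val u)%:Z,
                stores h u [seq aeval s e | e <- es]))
| step_store e e' s h a :
    addr_of_int (aeval s e) = Some a -> a \in domf h ->
    step (Run (Store e e') (s, h)) (Term (s, h.[a <- aeval s e']%fmap))
| step_store_fault e e' s h :
    lookup h (aeval s e) = None -> step (Run (Store e e') (s, h)) Fault
| step_fetch x e s h v :
    lookup h (aeval s e) = Some v ->
    step (Run (Fetch x e) (s, h)) (Term (upd s x v, h))
| step_fetch_fault x e s h :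
    lookup h (aeval s e) = None -> step (Run (Fetch x e) (s, h)) Fault
| step_free e s h a :
    addr_of_int (aeval s e) = Some a -> a \in domf h ->
    step (Run (Free e) (s, h)) (Term (s, h.[~ a]%fmap))
| step_free_fault e s h :
    lookup h (aeval s e) = None -> step (Run (Free e) (s, h)) Fault.

Definition diverges (k : config) : Prop :=
  exists f : nat -> config, f 0%N = k /\ forall n, step (f n) (f n.+1).

Definition valid_total (phi : formula) (c : prog) (psi : formula) : Prop :=
  forall sg, sat phi sg ->
    ~ diverges (Run c sg) /\
    (forall k, clos_refl_trans_1n config step (Run c sg) k ->
       (forall k', ~ step k k') ->
       exists2 tau, k = Term tau & sat psi tau).

(* Expectations are functions into [R]; membership in the set of
   [0,1]-valued ones is the predicate [bounded1]. *)
Definition expect : Type := state -> R.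

Definition bounded1 (X : expect) : Prop := forall sg, 0 <= X sg <= 1.

Definition exple (X Y : expect) : Prop := forall sg, X sg <= Y sg.

Definition ind (P : state -> Prop) : expect := fun sg => (`[< P sg >])%:R.

(* Infimum in [0,1] of a set of nonnegative reals; [inf01 set0 = 1]. *)
Definition inf01 (A : set R) : R := inf (1 |` A).

Definition esubst (X : expect) (x : V) (v : int) : expect :=
  fun sg => X (upd sg.1 x v, sg.2).

(* A heap has finitely many splittings, so this supremum is a maximum
   ([estar_attained] below). *)
Definition estar (X Y : expect) : expect := fun sg =>
  sup [set r | exists h1 h2 : heap,
    [/\ hdisj h1 h2, sg.2 = hunion h1 h2 & r = X (sg.1, h1) * Y (sg.1, h2)]].

Definition ewand (Y X : expect) : expect := fun sg =>
  inf01 [set X (sg.1, hunion sg.2 h') / Y (sg.1, h') |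
         h' in [set h' | hdisj sg.2 h' /\ 0 < Y (sg.1, h')]].

Definition esup (F : int -> expect) : expect := fun sg =>
  sup [set F v sg | v in [set: int]].

Fixpoint embed (phi : formula) : expect :=
  match phi with
  | FAtom a => ind (sat_atom a)
  | FNot f => fun sg => 1 - embed f sg
  | FAnd f g => fun sg => embed f sg * embed g sg
  | FEx x f => esup (fun v => esubst (embed f) x v)
  | FStar f g => estar (embed f) (embed g)
  | FWand f g => ewand (embed f) (embed g)
  end.

Definition is_lfp (F : expect -> expect) (Y : expect) : Prop :=
  [/\ bounded1 Y, F Y = Y &
      forall Z, bounded1 Z -> F Z = Z -> exple Y Z].

(* The default value of [xget] is never taken in [wp c X] for bounded [X]: see
   [wp_while_is_lfp] below. *)
Definition lfp (F : expect -> expect) : expect :=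
  xget (fun=> 0) [set Y | is_lfp F Y].

Fixpoint wp (c : prog) (X : expect) : expect :=
  match c with
  | Skip => X
  | Assign x e => fun sg => X (upd sg.1 x (aeval sg.1 e), sg.2)
  | Seq c1 c2 => wp c1 (wp c2 X)
  | If b c1 c2 => fun sg =>
      (beval sg.1 b)%:R * wp c1 X sg + (~~ beval sg.1 b)%:R * wp c2 X sg
  | While b c1 => lfp (fun Y sg =>
      (~~ beval sg.1 b)%:R * X sg + (beval sg.1 b)%:R * wp c1 Y sg)
  | PChoice c1 p c2 => fun sg =>
      p%:num * wp c1 X sg + (1 - p%:num) * wp c2 X sg
  | New x es => fun sg =>
      inf01 [set ewand (ind (points_to (EConst (addr_val v)%:Z) es))
                       (esubst X x (addr_val v)%:Z) sg |
             v in [set v : addr | fresh sg.2 v (size es)]]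
  | Store e e' =>
      estar (ind (points_to_any e)) (ewand (ind (points_to e [:: e'])) X)
  | Fetch x e => esup (fun v =>
      estar (ind (points_to e [:: EConst v]))
            (ewand (ind (points_to e [:: EConst v])) (esubst X x v)))
  | Free e => estar (ind (points_to_any e)) X
  end.

End Syntax.

Section WellDefined.
Variables (V : eqType) (R : realType).
Implicit Types (X Y Z : expect V R) (c : prog V R).

Lemma split_restrict (h : heap) (A : {fset addr}) :
  hdisj h.[& A]%fmap h.[\ A]%fmap /\ h = hunion h.[& A]%fmap h.[\ A]%fmap.
Proof.
split.
  apply/fdisjointP => a; rewrite !domf_restrict !in_fsetI in_fsetD.
  by case: (a \in A).
apply/fmapP => a; rewrite /hunion fnd_cat !fnd_restrict domf_restrict.
rewrite in_fsetI in_fsetD; case: (boolP (a \in A)) => //= aA.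
by case: (boolP (a \in domf h)) => //= ah; rewrite not_fnd.
Qed.

Lemma restrict_split (h h1 h2 : heap) : hdisj h1 h2 -> h = hunion h1 h2 ->
  [/\ (domf h1 `<=` domf h)%fset, h1 = h.[& domf h1]%fmap &
      h2 = h.[\ domf h1]%fmap].
Proof.
move=> d12 ->; split.
- by apply/fsubsetP => a a1; rewrite mem_catf a1.
- apply/fmapP => a; rewrite fnd_restrict /hunion fnd_cat.
  case: (boolP (a \in domf h1)) => a1; last by rewrite not_fnd.
  by rewrite ifN//; apply: (fdisjointP d12).
- apply/fmapP => a; rewrite fnd_restrict /hunion fnd_cat in_fsetD mem_catf.
  case: (boolP (a \in domf h2)) => a2.
    rewrite orbT andbT ifT//.
    by apply: contraTN a2; apply: (fdisjointP d12).
  rewrite (not_fnd a2) orbF.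
  by case: (boolP (a \in domf h1)) => a1.
Qed.

Lemma estar_attained X Y s h : exists h1 h2 : heap,
  [/\ hdisj h1 h2, h = hunion h1 h2,
      estar X Y (s, h) = X (s, h1) * Y (s, h2) &
      forall k1 k2 : heap, hdisj k1 k2 -> h = hunion k1 k2 ->
        X (s, k1) * Y (s, k2) <= X (s, h1) * Y (s, h2)].
Proof.
pose val (A : {fset addr}) := X (s, h.[& A]%fmap) * Y (s, h.[\ A]%fmap).
have [A AP Amax] : exists2 A, A \in fpowerset (domf h) &
    forall B, B \in fpowerset (domf h) -> val B <= val A.
  suff maxl (l : seq {fset addr}) B0 : B0 \in l ->
      exists2 A, A \in l & forall B, B \in l -> val B <= val A.
    by apply: (maxl (enum_fset (fpowerset (domf h))) fset0);
      rewrite [_ \in _]fpowersetE fsub0set.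
  elim: l B0 => // B l IH _ _.
  case: l IH => [_|C l /(_ C (mem_head _ _)) [A Al Amax]].
    by exists B => [|D]; [exact: mem_head|rewrite mem_seq1 => /eqP->].
  have [le_BA|lt_AB] := leP (val B) (val A).
    by exists A => [|D]; rewrite in_cons ?Al ?orbT// => /orP[/eqP->|/Amax].
  exists B => [|D]; rewrite in_cons ?eqxx// => /orP[/eqP->//|/Amax le_DA].
  exact: le_trans le_DA (ltW lt_AB).
have ubA (k1 k2 : heap) : hdisj k1 k2 -> h = hunion k1 k2 ->
    X (s, k1) * Y (s, k2) <= val A.
  move=> d12 hE; have [s1 e1 e2] := restrict_split d12 hE.
  by rewrite e1 e2 -/(val _); apply: Amax; rewrite fpowersetE.
have [dA hA] := split_restrict h A.
exists h.[& A]%fmap, h.[\ A]%fmap; split => //.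
have inA : [set r | exists h1 h2 : heap,
    [/\ hdisj h1 h2, h = hunion h1 h2 & r = X (s, h1) * Y (s, h2)]] (val A).
  by exists h.[& A]%fmap, h.[\ A]%fmap.
have ub : ubound [set r | exists h1 h2 : heap,
    [/\ hdisj h1 h2, h = hunion h1 h2 & r = X (s, h1) * Y (s, h2)]] (val A).
  by move=> _ [h1 [h2 [d12 hE ->]]]; exact: ubA.
apply/eqP; rewrite eq_le; apply/andP; split.
  by apply: ge_sup => //; exists (val A).
by apply: ub_le_sup => //; exists (val A).
Qed.

Lemma inf01_bounded (A : set R) : (forall x, A x -> 0 <= x) ->
  0 <= inf01 A <= 1.
Proof.
move=> A0; have lb0 : lbound (1 |` A) 0 by move=> x [->|/A0].
apply/andP; split; first by apply: lb_le_inf => //; exists 1; left.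
by apply: ge_inf; [exists 0|left].
Qed.

Lemma inf01_le T (D : set T) (f g : T -> R) :
  (forall i, D i -> 0 <= f i <= g i) ->
  inf01 [set f i | i in D] <= inf01 [set g i | i in D].
Proof.
move=> fg.
have lb0 : has_lbound (1 |` [set f i | i in D]).
  by exists 0 => _ [->|[i /fg /andP[? _] <-]].
apply: lb_le_inf => [|_ [->|[i Di <-]]]; first by exists 1; left.
  by apply: ge_inf => //; left.
have /andP[_] := fg i Di; apply: le_trans.
by apply: ge_inf => //; right; exists i.
Qed.

Lemma estar_bounded X Y : bounded1 X -> bounded1 Y -> bounded1 (estar X Y).
Proof.
move=> bX bY [s h]; have [h1 [h2 [_ _ -> _]]] := estar_attained X Y s h.
have /andP[X0 X1] := bX (s, h1); have /andP[Y0 Y1] := bY (s, h2).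
by rewrite mulr_ge0// mulr_ile1.
Qed.

Lemma estar_le X Y Z : bounded1 X -> exple Y Z -> exple (estar X Y) (estar X Z).
Proof.
move=> bX YZ [s h]; have [h1 [h2 [d12 hE -> _]]] := estar_attained X Y s h.
have [k1 [k2 [_ _ -> kmax]]] := estar_attained X Z s h.
apply: le_trans (kmax _ _ d12 hE); apply: ler_wpM2l => //.
by have /andP[] := bX (s, h1).
Qed.

Lemma ewand_bounded Y X : bounded1 X -> bounded1 (ewand Y X).
Proof.
move=> bX [s h]; apply: inf01_bounded => _ [h' [_ Y0] <-].
by rewrite divr_ge0 ?(ltW Y0)//; have /andP[] := bX (s, hunion h h').
Qed.

Lemma ewand_le Y X Z : bounded1 X -> exple X Z -> exple (ewand Y X) (ewand Y Z).
Proof.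
move=> bX XZ [s h]; apply: inf01_le => h' [_ Y0].
have /andP[X0 _] := bX (s, hunion h h').
by rewrite divr_ge0 ?(ltW Y0)//= ler_pM2r ?invr_gt0// XZ.
Qed.

Lemma esup_bounded (F : int -> expect V R) :
  (forall v, bounded1 (F v)) -> bounded1 (esup F).
Proof.
move=> bF sg; have ub : ubound [set F v sg | v in [set: int]] 1.
  by move=> _ [v _ <-]; have /andP[] := bF v sg.
apply/andP; split; last by apply: ge_sup => //; exists (F 0 sg), 0.
have /andP[F0 _] := bF 0 sg; apply: (le_trans F0).
by apply: ub_le_sup; [exists 1|exists 0].
Qed.

Lemma esup_le (F G : int -> expect V R) : (forall v, bounded1 (G v)) ->
  (forall v, exple (F v) (G v)) -> exple (esup F) (esup G).
Proof.
move=> bG FG sg; apply: ge_sup => [|_ [v _ <-]]; first by exists (F 0 sg), 0.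
apply: (le_trans (FG v sg)); apply: ub_le_sup; last by exists v.
by exists 1 => _ [w _ <-]; have /andP[] := bG w sg.
Qed.

Lemma ind_bounded P : bounded1 (@ind V R P).
Proof. by move=> sg; rewrite /ind; case: asboolP; rewrite ?ler01 ?lexx. Qed.

Lemma lfpP (F : expect V R -> expect V R) :
  (forall Y, bounded1 Y -> bounded1 (F Y)) ->
  (forall Y Z, bounded1 Y -> bounded1 Z -> exple Y Z -> exple (F Y) (F Z)) ->
  is_lfp F (lfp F) /\
  (forall Z, bounded1 Z -> exple (F Z) Z -> exple (lfp F) Z).
Proof.
move=> bF leF; suff [L Llfp Lle] : exists2 L, is_lfp F L &
    forall Z, bounded1 Z -> exple (F Z) Z -> exple L Z.
  have [b FE leZ] : is_lfp F (lfp F) by apply: (xgetPex (fun=> 0)); exists L.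
  split=> // Z bZ FZ sg; apply: le_trans (Lle Z bZ FZ sg).
  by have [bL FL _] := Llfp; apply: leZ.
pose S sg := [set Y sg | Y in [set Y | bounded1 Y /\ exple (F Y) Y]].
pose L : expect V R := fun sg => inf01 (S sg).
have Lb : bounded1 L.
  move=> sg; apply: inf01_bounded => _ [Y [bY _] <-].
  by have /andP[] := bY sg.
have Lle Y : bounded1 Y -> exple (F Y) Y -> exple L Y.
  move=> bY FY sg; apply: ge_inf; last by right; exists Y.
  exists 0 => _ [->//|[Z [bZ _] <-]]; by have /andP[] := bZ sg.
have FL : exple (F L) L.
  move=> sg; apply: lb_le_inf => [|_ [->|[Y [bY FY] <-]]].
  - by exists 1; left.
  - by have /andP[] := bF L Lb sg.
  - exact: le_trans (leF _ _ Lb bY (Lle Y bY FY) sg) (FY sg).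
have LF : exple L (F L) by apply: Lle (bF _ Lb) (leF _ _ (bF _ Lb) Lb FL).
exists L => //; split => //.
  by apply/funext => sg; apply/eqP; rewrite eq_le FL LF.
by move=> Z bZ FZ; apply: Lle => // sg; rewrite FZ.
Qed.

Let loop_body b c X Y : expect V R := fun sg =>
  (~~ beval sg.1 b)%:R * X sg + (beval sg.1 b)%:R * wp c Y sg.

Lemma loop_body_bounded b c X :
  (forall Y, bounded1 Y -> bounded1 (wp c Y)) -> bounded1 X ->
  forall Y, bounded1 Y -> bounded1 (loop_body b c X Y).
Proof.
move=> bc bX Y bY sg; rewrite /loop_body.
case: (beval _ _); rewrite /= ?mul1r ?mul0r ?addr0 ?add0r//; exact: bc.
Qed.

Lemma loop_body_le b c X :
  (forall Y Z, bounded1 Y -> bounded1 Z -> exple Y Z ->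
     exple (wp c Y) (wp c Z)) ->
  forall Y Z, bounded1 Y -> bounded1 Z -> exple Y Z ->
    exple (loop_body b c X Y) (loop_body b c X Z).
Proof.
move=> lc Y Z bY bZ YZ sg; rewrite /loop_body.
case: (beval _ _); rewrite /= ?mul1r ?mul0r ?addr0 ?add0r//; exact: lc.
Qed.

Lemma wp_bounded_le c :
  (forall X, bounded1 X -> bounded1 (wp c X)) /\
  (forall X Y, bounded1 X -> bounded1 Y -> exple X Y ->
     exple (wp c X) (wp c Y)).
Proof.
have bsub X x v : bounded1 X -> bounded1 (esubst X x v) by move=> bX sg; apply: bX.
have lesub X Y x v : exple X Y -> exple (esubst X x v) (esubst Y x v).
  by move=> XY sg; apply: XY.
elim: c => [|x e|c1 [b1 l1] c2 [b2 l2]|b c1 [b1 l1] c2 [b2 l2]|b c1 [b1 l1]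
  |c1 [b1 l1] p c2 [b2 l2]|x es|e e'|x e|e] /=; split => // [X bX|X Y bX bY XY].
- by move=> sg; apply: bX.
- by move=> sg; apply: XY.
- by apply: b1; apply: b2.
- by apply: l1 (l2 _ _ bX bY XY); apply: b2.
- move=> sg; case: (beval _ _); rewrite /= ?mul1r ?mul0r ?addr0 ?add0r.
    exact: b1.
  exact: b2.
- move=> sg; case: (beval _ _); rewrite /= ?mul1r ?mul0r ?addr0 ?add0r.
    exact: l1.
  exact: l2.
- have [[bT _ _] _] := lfpP (loop_body_bounded b b1 bX) (loop_body_le b X l1).
  exact: bT.
- have [[bT FT _] _] := lfpP (loop_body_bounded b b1 bY) (loop_body_le b Y l1).
  have [_] := lfpP (loop_body_bounded b b1 bX) (loop_body_le b X l1).
  apply=> // sg; rewrite -[leRHS](congr1 (@^~ sg) FT) /loop_body.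
  by rewrite lerD2r ler_wpM2l.
- move=> sg; have /andP[X0 X1] := b1 X bX sg; have /andP[Y0 Y1] := b2 X bX sg.
  have p0 : 0 <= p%:num by []. have p1 : p%:num <= 1 by [].
  rewrite addr_ge0 ?mulr_ge0 ?subr_ge0//=.
  rewrite -[leRHS](subrKC p%:num); apply: lerD.
    by rewrite ler_piMr.
  by rewrite ler_piMr// subr_ge0.
- move=> sg; apply: lerD; apply: ler_wpM2l; rewrite ?subr_ge0//.
    exact: l1.
  exact: l2.
- move=> sg; apply: inf01_bounded => _ [v _ <-].
  by have /andP[] := ewand_bounded (ind R (points_to (EConst V (addr_val v)%:Z) es))
    (bsub _ x (addr_val v)%:Z bX) sg.
- move=> sg; apply: inf01_le => v _; rewrite ewand_le ?andbT//.
  - by have /andP[] := ewand_bounded (ind R (points_to (EConst V (addr_val v)%:Z) es))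
      (bsub _ x (addr_val v)%:Z bX) sg.
  - exact: bsub.
  - exact: lesub.
- by apply: estar_bounded (ind_bounded _) (ewand_bounded _ bX).
- by apply: estar_le (@ind_bounded _) _; apply: ewand_le.
- apply: esup_bounded => v.
  by apply: estar_bounded (ind_bounded _) (ewand_bounded _ (bsub _ _ _ bX)).
- apply: esup_le => v.
    by apply: estar_bounded (ind_bounded _) (ewand_bounded _ (bsub _ _ _ bY)).
  apply: estar_le (@ind_bounded _) _.
  by apply: ewand_le; [apply: bsub|apply: lesub].
- by apply: estar_bounded (ind_bounded _) bX.
- by apply: estar_le (@ind_bounded _) XY.
Qed.

Lemma wp_while_is_lfp b c X : bounded1 X ->
  is_lfp (loop_body b c X) (wp (While b c) X).
Proof.
move=> bX; have [bc lc] := wp_bounded_le c; apply: (proj1 (lfpP _ _)).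
  exact: loop_body_bounded.
exact: loop_body_le.
Qed.

End WellDefined.

(* Main.v *)
(* Embedded formulas are indicators, and so is [wp c X] for an indicator [X] and
   a nonprobabilistic [c]: it is the indicator of the states from which every run
   of [c] ends, without fault, in [X].  This set of states is described by an
   inductive predicate [must], whose induction principle replaces ordinals in the
   loop case, where allocation makes the branching infinite and the least fixed
   point is not reached at stage omega. *)
Require Import Defs.
From Stdlib Require Import Relations.
From mathcomp Require Import all_boot all_order all_algebra finmap.
From mathcomp Require Import boolp classical_sets reals interval_inference.

Set Implicit Arguments.
Unset Strict Implicit.
Unset Printing Implicit Defensive.

Import Order.TTheory GRing.Theory Num.Theory.
Local Open Scope ring_scope.
Local Open Scope classical_set_scope.

(** * Heaps as finite maps: lookup, block allocation, disjoint union *)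

Section Heaps.
Implicit Types (h : heap) (u a : addr).

Lemma addr_of_intP z a : addr_of_int z = Some a <-> z = (addr_val a)%:Z.
Proof.
split=> [|->]; last exact: (valK a).
case: z => //= n; case: insubP => // b _ <- [->] //.
Qed.

Lemma lookup_addr h a : lookup h (addr_val a)%:Z = h.[? a]%fmap.
Proof.
by rewrite /lookup (_ : addr_of_int _ = Some a) //; apply/addr_of_intP.
Qed.

Lemma lookup_someP h z v :
  lookup h z = Some v <->
  exists2 a, addr_of_int z = Some a & h.[? a]%fmap = Some v.
Proof.
rewrite /lookup; case: (addr_of_int z) => [a|] /=; split=> //.
- by move=> ha; exists a.
- by case=> b [->].
- by case.
Qed.

Lemma lookup_memP h z a : addr_of_int z = Some a ->
  lookup h z <> None <-> a \in domf h.
Proof.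
move=> za; rewrite /lookup za /=; case: fndP => ah; split=> //.
Qed.

Lemma hunionC h1 h2 : hdisj h1 h2 -> hunion h1 h2 = hunion h2 h1.
Proof.
move=> d; apply/fmapP => a; rewrite /hunion !fnd_cat.
case: (boolP (a \in domf h2)) => a2; case: (boolP (a \in domf h1)) => a1 //.
- by have := fdisjointP d _ a1; rewrite a2.
- by rewrite !not_fnd.
Qed.

Lemma hdisjC h1 h2 : hdisj h1 h2 = hdisj h2 h1.
Proof. by rewrite /hdisj fdisjoint_sym. Qed.

Lemma fnd_stores h u vs a :
  (stores h u vs).[? a]%fmap =
  if (addr_val u <= addr_val a < addr_val u + size vs)%N
  then Some (nth 0 vs (addr_val a - addr_val u)) else h.[? a]%fmap.
Proof.
(* The value written at an address depends on its offset alone, so the writes may come in any order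
   and the induction can run over an arbitrary list of offsets. *)
have fnd_foldr l : (foldr (fun i (h' : heap) => h'.[shift u i <- nth 0 vs i]%fmap)
      h l).[? a]%fmap =
    if has (fun i => shift u i == a) l
    then Some (nth 0 vs (addr_val a - addr_val u)) else h.[? a]%fmap.
  elim: l => //= i l IH; rewrite fnd_set eq_sym IH.
  by case: eqP => //= <-; rewrite addKn.
rewrite /stores fnd_foldr; congr (if _ then _ else _).
apply/hasP/andP => [[i] |[ua au]].
  by rewrite mem_iota add0n => /= ilt /eqP<- /=; rewrite leq_addr ltn_add2l.
exists (addr_val a - addr_val u)%N; last by apply/eqP/val_inj => /=; rewrite subnKC.
by rewrite mem_iota add0n /= ltn_subLR.
Qed.

Lemma mem_stores0 u vs a :
  (a \in domf (stores fmap0 u vs)) =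
  (addr_val u <= addr_val a < addr_val u + size vs)%N.
Proof. by rewrite -fndSome fnd_stores fnd_fmap0; case: ifP. Qed.

(** Translates the side condition of allocation into the disjointness demanded by the magic wand;
    with [hunion_stores0], allocating in place amounts to adjoining a separate block. *)
Lemma hdisj_stores0 h u vs : hdisj h (stores fmap0 u vs) <-> fresh h u (size vs).
Proof.
rewrite hdisjC /hdisj; split=> [/fdisjointP d i ilt|fr].
  by apply: d; rewrite mem_stores0 /= leq_addr ltn_add2l.
apply/fdisjointP => a; rewrite mem_stores0 => /andP[ua au].
rewrite (_ : a = shift u (addr_val a - addr_val u)).
  by apply: fr; rewrite ltn_subLR.
by apply: val_inj => /=; rewrite subnKC.
Qed.

Lemma hunion_stores0 h u vs : hunion h (stores fmap0 u vs) = stores h u vs.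
Proof.
apply/fmapP => a; rewrite /hunion fnd_cat mem_stores0 !fnd_stores.
by case: (_ && _).
Qed.

Lemma stores1 h u v : stores h u [:: v] = h.[u <- v]%fmap.
Proof.
by rewrite /stores /= (_ : shift u 0 = u) //; apply: val_inj => /=; rewrite addn0.
Qed.

(** Guarantees that allocation never gets stuck: every cell above the largest allocated address is
    free. *)
Lemma fresh_exists h n : exists u, fresh h u n.
Proof.
pose m := (\max_(a <- domf h) addr_val a)%N.
exists (@Addr m.+1 isT) => i _; apply/negP => mem_h.
have := leq_bigmax_seq (F := addr_val) (P := xpredT) _ mem_h isT.
by rewrite -/m /= leqNgt ltnS leq_addr.
Qed.

End Heaps.

(** * Points-to assertions in the combinations of star and wand that occur in [wp] *)

Section PointsTo.
Variable V : eqType.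
Implicit Types (e : aexpr V) (es : seq (aexpr V)) (s : stack V) (h : heap).

(** Points-to is precise: domain and contents are both prescribed, so a single heap satisfies it
    once [e] denotes a genuine address. This is what collapses the quantifier over heaps in a
    wand. *)
Lemma points_toE e es s h u : aeval s e = (addr_val u)%:Z ->
  points_to e es (s, h) <-> h = stores fmap0 u [seq aeval s e | e <- es].
Proof.
move=> eu; rewrite /points_to eu; split=> [[dom_h val_h]|->].
  apply/fmapP => a; rewrite fnd_stores size_map fnd_fmap0.
  case: ifP => [/andP[ua au]|/negP nua].
    have ilt : (addr_val a - addr_val u < size es)%N by rewrite ltn_subLR.
    have := val_h _ ilt; rewrite -PoszD subnKC // lookup_addr => ->.
    by rewrite (nth_map (EConst V 0)).
  have := dom_h (addr_val a)%:Z; rewrite lookup_addr.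
  case: (h.[? a]%fmap) => // v [+ _]; case=> // i ilt; rewrite -PoszD => -[] au; case: nua.
  by rewrite au leq_addr ltn_add2l.
split=> [z|i ilt]; last first.
  rewrite -PoszD -[(_ + i)%N]/(addr_val (shift u i)) lookup_addr fnd_stores.
  by rewrite /= size_map leq_addr ltn_add2l ilt addKn (nth_map (EConst V 0)).
split.
  case za: (addr_of_int z) => [a|]; last by rewrite /lookup za.
  move/(lookup_memP _ za); rewrite mem_stores0 size_map => /andP[ua au].
  exists (addr_val a - addr_val u)%N; first by rewrite ltn_subLR.
  by rewrite -PoszD subnKC //; apply/addr_of_intP.
case=> i ilt ->; rewrite -PoszD -[(_ + i)%N]/(addr_val (shift u i)) lookup_addr.
by rewrite fnd_stores /= size_map leq_addr ltn_add2l ilt.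
Qed.

Lemma points_to_anyP e s h :
  points_to_any e (s, h) <->
  exists2 a, addr_of_int (aeval s e) = Some a & domf h = [fset a]%fset.
Proof.
split=> [dom_h|[a ea dom_h] z].
  case ea: (addr_of_int (aeval s e)) => [a|]; last first.
    by have := (dom_h (aeval s e)).2 erefl; rewrite /lookup ea.
  exists a => //; apply/fsetP => b; rewrite in_fset1.
  have zb : addr_of_int (addr_val b)%:Z = Some b by apply/addr_of_intP.
  apply/idP/eqP => [/(lookup_memP _ zb)/dom_h bE|->].
    by move: ea; rewrite -bE zb => -[].
  by apply/(lookup_memP _ ea)/dom_h.
split=> [|->]; last by apply/(lookup_memP _ ea); rewrite dom_h in_fset1.
case zb: (addr_of_int z) => [b|]; last by rewrite /lookup zb.
move/(lookup_memP _ zb); rewrite dom_h in_fset1 => /eqP ba.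
by move/addr_of_intP: zb => ->; move/addr_of_intP: ea => ->; rewrite ba.
Qed.

(** The first part of the splitting is confined to one cell, which leaves no choice for the rest.
    The arbitrary [Q] covers both deallocation and writing, where [Q] is itself a wand. *)
Lemma star_points_to_anyP e s h (Q : heap -> Prop) :
  (exists h1 h2 : heap,
     [/\ hdisj h1 h2, h = hunion h1 h2, points_to_any e (s, h1) & Q h2]) <->
  exists a, [/\ addr_of_int (aeval s e) = Some a, a \in domf h & Q h.[~ a]%fmap].
Proof.
split=> [[h1 [h2 [d hE /points_to_anyP[a ea dom1] Qh2]]]|[a [ea ah Qh]]].
  have [/fsubsetP sub _ h2E] := restrict_split d hE.
  exists a; split=> //; first by apply: sub; rewrite dom1 in_fset1.
  by rewrite -dom1 -h2E.
have [d hE] := split_restrict h [fset a]%fset.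
exists h.[& [fset a]%fset]%fmap, h.[~ a]%fmap; split=> //.
apply/points_to_anyP; exists a => //.
by rewrite domf_restrict; apply/fsetIidPl; rewrite fsub1set.
Qed.

(** By [points_toE] only one extension [h'] counts, and it is disjoint from [h] exactly when the
    block is fresh; otherwise both sides hold vacuously. *)
Lemma wand_points_toP e es s h u (Q : heap -> Prop) :
  aeval s e = (addr_val u)%:Z ->
  (forall h', hdisj h h' -> points_to e es (s, h') -> Q (hunion h h')) <->
  (fresh h u (size es) -> Q (stores h u [seq aeval s e | e <- es])).
Proof.
move=> eu; split=> [Qh fr|Qh h' d /(points_toE _ _ eu) h'E].
  rewrite -hunion_stores0; apply: Qh; last exact/(points_toE _ _ eu).
  by apply/hdisj_stores0; rewrite size_map.
move: d; rewrite h'E => /hdisj_stores0; rewrite size_map => /Qh.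
by rewrite hunion_stores0.
Qed.

Lemma lookup_points_to1 e s h v :
  points_to e [:: EConst V v] (s, h) -> lookup h (aeval s e) = Some v.
Proof. by case=> _ /(_ 0%N isT); rewrite addr0. Qed.

Lemma lookup_hunionl h1 h2 z v :
  hdisj h1 h2 -> lookup h1 z = Some v -> lookup (hunion h1 h2) z = Some v.
Proof.
move=> d /lookup_someP[a za h1a]; apply/lookup_someP; exists a => //.
rewrite /hunion fnd_cat ifN //; apply: (fdisjointP d).
by rewrite -fndSome h1a.
Qed.

(** Reading cuts a cell out and puts the same cell back, so the heap returns unchanged and [Q] is
    evaluated at [h] itself. *)
Lemma star_wand_points_toP e s h v (Q : heap -> Prop) :
  (exists h1 h2 : heap, [/\ hdisj h1 h2, h = hunion h1 h2,
     points_to e [:: EConst V v] (s, h1) &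
     forall h', hdisj h2 h' -> points_to e [:: EConst V v] (s, h') ->
       Q (hunion h2 h')]) <->
  lookup h (aeval s e) = Some v /\ Q h.
Proof.
split=> [[h1 [h2 [d -> pt Qh]]]|[]].
  split; first exact: lookup_hunionl (lookup_points_to1 pt).
  (* The cell [h1] that was cut out is itself an admissible [h']. *)
  by rewrite hunionC //; apply: Qh => //; rewrite hdisjC.
move=> /lookup_someP[a ea ha] Qh.
have eu := (addr_of_intP _ _).1 ea.
have fr : fresh h.[~ a]%fmap a (size [:: v]).
  move=> [|//] _; rewrite (_ : shift a 0 = a) ?mem_remfF //.
  by apply: val_inj => /=; rewrite addn0.
have hE : hunion h.[~ a]%fmap (stores fmap0 a [:: v]) = h.
  rewrite hunion_stores0 stores1; apply/fmapP => b.
  by rewrite fnd_set fnd_rem1; case: eqP => [->|].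
have d := (hdisj_stores0 _ _ _).2 fr.
exists (stores fmap0 a [:: v]), h.[~ a]%fmap; split.
- by rewrite hdisjC.
- by rewrite -hunionC.
- exact/(points_toE _ _ eu).
- by move=> h' _ /(points_toE _ _ eu) /= ->; rewrite hE.
Qed.

End PointsTo.

(** * Indicators are closed under the operations on expectations *)

Section Indicators.
Variables (V : eqType) (R : realType).
Implicit Types (P Q : state V -> Prop).

Lemma ind_eq P Q : (forall sg, P sg <-> Q sg) -> ind R P = ind R Q.
Proof. by move=> PQ; congr ind; apply/funext => sg; apply/propext. Qed.

Lemma ind_ge1 P sg : 1 <= ind R P sg <-> P sg.
Proof. by rewrite /ind; case: asboolP => p; rewrite ?lexx // ler10; split. Qed.

Lemma ind_gt0 P sg : 0 < ind R P sg <-> P sg.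
Proof. by rewrite /ind; case: asboolP => p; rewrite ?ltr01 ?ltxx; split. Qed.

Lemma ind_true P sg : P sg -> ind R P sg = 1.
Proof. by rewrite /ind => p; rewrite asboolT. Qed.

Lemma ind_false P sg : ~ P sg -> ind R P sg = 0.
Proof. by rewrite /ind => p; rewrite asboolF. Qed.

Lemma ind_exple P (X : expect V R) : bounded1 X ->
  exple (ind R P) X <-> forall sg, P sg -> 1 <= X sg.
Proof.
move=> bX; split=> PX sg; first by move=> p; rewrite -(ind_true p); apply: PX.
have [p|p] := pselect (P sg); first by rewrite (ind_true p); apply: PX.
by rewrite (ind_false p); have /andP[] := bX sg.
Qed.

(** The supremum is attained, so the product of the two indicators reaches 1 at some splitting or
    vanishes at all of them. *)
Lemma estar_ind P Q :
  estar (ind R P) (ind R Q) = ind R (fun sg => exists h1 h2 : heap,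
    [/\ hdisj h1 h2, sg.2 = hunion h1 h2, P (sg.1, h1) & Q (sg.1, h2)]).
Proof.
apply/funext => -[s h].
have [h1 [h2 [d hE -> hmax]]] := estar_attained (ind R P) (ind R Q) s h.
have [[k1 [k2 [kd kE Pk Qk]]]|n] := pselect (exists h1 h2 : heap,
    [/\ hdisj h1 h2, h = hunion h1 h2, P (s, h1) & Q (s, h2)]).
  rewrite [RHS]ind_true; last by exists k1, k2.
  apply/eqP; rewrite eq_le; apply/andP; split.
    have /andP[? ?] := @ind_bounded V R P (s, h1).
    by have /andP[? ?] := @ind_bounded V R Q (s, h2); rewrite mulr_ile1.
  by have := hmax _ _ kd kE; rewrite (ind_true Pk) (ind_true Qk) mulr1.
rewrite [RHS]ind_false //.
have [p|p] := pselect (P (s, h1)); last by rewrite (ind_false p) mul0r.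
have [q|q] := pselect (Q (s, h2)); last by rewrite (ind_false q) mulr0.
by case: n; exists h1, h2.
Qed.

(** The 1 adjoined in [inf01] gives the value 1 for empty [D], in agreement with the vacuous
    quantifier. *)
Lemma inf01_ind T (D : set T) (f : T -> R) (A : T -> Prop) :
  (forall i, D i -> f i = (`[< A i >])%:R) ->
  inf01 [set f i | i in D] = (`[< forall i, D i -> A i >])%:R.
Proof.
move=> fE; have f0 x : [set f i | i in D] x -> 0 <= x.
  by case=> i Di <-; rewrite fE.
have /andP[i0 i1] := inf01_bounded f0.
have lb : has_lbound (1 |` [set f i | i in D]).
  by exists 0 => x [->|/f0].
apply/eqP; rewrite eq_le; case: asboolP => [all|/existsNP[i /not_implyP[Di nA]]].
  rewrite i1; apply: lb_le_inf; first by exists 1; left.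
  by move=> _ [->|[i Di <-]] //; rewrite fE // asboolT //; apply: all.
rewrite i0 andbT; apply: ge_inf => //; right; exists i => //.
by rewrite fE // asboolF.
Qed.

(** The infimum runs only over heaps where the denominator is positive; an indicator is then 1, and
    the division disappears. *)
Lemma ewand_ind P Q :
  ewand (ind R P) (ind R Q) = ind R (fun sg => forall h' : heap,
    hdisj sg.2 h' -> P (sg.1, h') -> Q (sg.1, hunion sg.2 h')).
Proof.
apply/funext => -[s h]; rewrite /ewand /=.
rewrite (inf01_ind (A := fun h' => Q (s, hunion h h'))) => [|h' [_ /ind_gt0 p]].
  congr (nat_of_bool _)%:R; apply: asbool_equiv_eq; split=> H h'.
    by move=> d p; apply: H; split=> //; apply/ind_gt0.
  by case=> d /ind_gt0; apply: H.
by rewrite (ind_true p) divr1.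
Qed.

Lemma esup_ind (P : int -> state V -> Prop) :
  esup (fun v => ind R (P v)) = ind R (fun sg => exists v, P v sg).
Proof.
apply/funext => sg.
have /andP[s0 s1] := esup_bounded (fun v => @ind_bounded V R (P v)) sg.
have [[v p]|n] := pselect (exists v, P v sg).
  rewrite [RHS]ind_true; last by exists v.
  apply/eqP; rewrite eq_le s1 -(ind_true p) /=; apply: ub_le_sup; last by exists v.
  by exists 1 => _ [w _ <-]; have /andP[] := @ind_bounded V R (P w) sg.
rewrite [RHS]ind_false //; apply/eqP; rewrite eq_le s0 andbT.
apply: ge_sup => [|_ [v _ <-]]; first by exists (ind R (P 0) sg), 0.
by rewrite ind_false // => p; apply: n; exists v.
Qed.

Lemma embed_ind (phi : formula V) : embed R phi = ind R (sat phi).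
Proof.
elim: phi => [a|f IHf|f IHf g IHg|x f IHf|f IHf g IHg|f IHf g IHg] /=.
- by apply: ind_eq => -[].
- apply/funext => -[s h]; rewrite IHf /ind /= asbool_neg.
  by case: asboolP; rewrite ?subrr ?subr0.
- apply/funext => -[s h]; rewrite IHf IHg /ind /= asbool_and.
  by do 2!case: asboolP; rewrite ?mulr0 ?mul0r ?mulr1.
(* A substitution instance of an indicator is an indicator by computation; the change of form
   exposes this to [esup_ind]. *)
- by rewrite IHf -[esup _]/(esup (fun v => ind R _)) esup_ind; apply: ind_eq => -[].
- by rewrite IHf IHg estar_ind; apply: ind_eq => -[].
- by rewrite IHf IHg ewand_ind; apply: ind_eq => -[].
Qed.

End Indicators.

(** * Runs that must succeed, and their agreement with [wp] *)

Section MustTerminate.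
Variables (V : eqType) (R : realType).
Implicit Types (P Q T : state V -> Prop) (c : prog V R) (sg tau : state V).

Inductive must Q : config V R -> Prop :=
| must_term tau : Q tau -> must Q (Term R tau)
| must_run c sg :
    (forall k, step (Run c sg) k -> must Q k) -> must Q (Run c sg).

Lemma must_termE Q tau : must Q (Term R tau) <-> Q tau.
Proof. by split=> [m|]; [inversion m|exact: must_term]. Qed.

Lemma must_runE Q c sg :
  must Q (Run c sg) <-> forall k, step (Run c sg) k -> must Q k.
Proof. by split=> [m|]; [inversion m|exact: must_run]. Qed.

Lemma must_fault Q : ~ must Q (Fault V R).
Proof. by move=> m; inversion m. Qed.

Lemma progress c sg : exists k, step (Run c sg) k.
Proof.
elim: c sg => [|x e|c1 IH1 c2 IH2|b c1 IH1 c2 IH2|b c1 IH1|c1 IH1 p c2 IH2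
  |x es|e e'|x e|e] [s h].
- by eexists; constructor.
- by eexists; constructor.
- have [[c1' sg'|sg'|] st] := IH1 (s, h).
  + by eexists; apply: step_seq_run st.
  + by eexists; apply: step_seq_term st.
  + by eexists; apply: step_seq_fault st.
- case: (boolP (beval s b)) => hb.
  + by eexists; apply: step_if_true.
  + by eexists; apply: step_if_false.
- case: (boolP (beval s b)) => hb.
  + by eexists; apply: step_while_true.
  + by eexists; apply: step_while_false.
- have [p0|p0] := ltP 0 p%:num.
  + by eexists; apply: step_choice_left.
  + by eexists; apply: step_choice_right; apply: le_lt_trans p0 ltr01.
- by have [u fr] := fresh_exists h (size es); eexists; apply: step_new fr.
- case E: (lookup h (aeval s e)) => [v|].
  + have [a ea ha] := (lookup_someP _ _ _).1 E.
    by eexists; apply: step_store ea _; rewrite -fndSome ha.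
  + by eexists; apply: step_store_fault.
- case E: (lookup h (aeval s e)) => [v|].
  + by eexists; apply: step_fetch E.
  + by eexists; apply: step_fetch_fault.
- case E: (lookup h (aeval s e)) => [v|].
  + have [a ea ha] := (lookup_someP _ _ _).1 E.
    by eexists; apply: step_free ea _; rewrite -fndSome ha.
  + by eexists; apply: step_free_fault.
Qed.

Lemma must_step Q k k' : must Q k -> step k k' -> must Q k'.
Proof. by case=> [tau _ st|c sg]; [inversion st|apply]. Qed.

Lemma must_not_diverges Q k : must Q k -> ~ diverges k.
Proof.
elim=> [tau _ [f [f0 fS]]|c sg _ IH [f [f0 fS]]].
  by have := fS 0%N; rewrite f0 => st; inversion st.
have := fS 0%N; rewrite f0 => /IH; apply.
by exists (fun n => f n.+1).
Qed.

(** Steps preserve [must], so it still holds at the end of the run, and [progress] forbids that the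
    end is a [Run]. *)
Lemma must_normal_form Q k k' : must Q k ->
  clos_refl_trans_1n _ (@step V R) k k' -> (forall k'', ~ step k' k'') ->
  exists2 tau, k' = Term R tau & Q tau.
Proof.
move=> m r; elim: r m => {k k'} [k m nf|k k1 k2 st _ IH m]; last first.
  exact/IH/(must_step m).
case: m nf => [tau q _|c sg _ nf]; first by exists tau.
by have [k' /nf] := progress c sg.
Qed.

(** A reachable configuration outside [must Q] always has a successor outside [must Q]; iterating a
    choice function for it produces an infinite run from [k]. *)
Lemma not_diverges_must Q k : ~ diverges k ->
  (forall k', clos_refl_trans_1n _ (@step V R) k k' -> (forall k'', ~ step k' k'') ->
    exists2 tau, k' = Term R tau & Q tau) ->
  must Q k.
Proof.
move=> ndiv nf; apply: contrapT => nm; apply: ndiv.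
(* A reachable normal form would be final with [Q], hence in [must Q]; so [k1] is a [Run], and not
   all its successors can lie in [must Q]. *)
have next k1 : clos_refl_trans_1n _ (@step V R) k k1 /\ ~ must Q k1 ->
    exists k2, step k1 k2 /\ ~ must Q k2.
  case=> r n1; have [[k2 st]|nst] := pselect (exists k2, step k1 k2); last first.
    case: n1; have [|tau -> q] := nf _ r; last exact: must_term.
    by move=> k2 st; apply: nst; exists k2.
  case: k1 st r n1 => [c sg|tau|] st r n1; [|by inversion st|by inversion st].
  apply: contrapT => /forallNP all; apply: n1; apply: must_run => k3 st3.
  by apply: contrapT => n3; apply: (all k3).
(* [choice] asks for a total relation, so [k1] itself serves as a dummy successor where the
   invariant fails. *)
have good k1 : exists k2,
    clos_refl_trans_1n _ (@step V R) k k1 /\ ~ must Q k1 ->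
    step k1 k2 /\ ~ must Q k2.
  have [/next[k2 ?]|n] := pselect (clos_refl_trans_1n _ (@step V R) k k1 /\ ~ must Q k1).
    by exists k2.
  by exists k1.
have [f fP] := choice good.
have inv n : clos_refl_trans_1n _ (@step V R) k (iter n f k) /\ ~ must Q (iter n f k).
  elim: n => [|n IH]; first by split=> //; constructor.
  have [st n'] := fP _ IH; split=> //=.
  apply/clos_rt_rt1n/(rt_trans _ _ _ _ _ _ (rt_step _ _ _ _ st)).
  exact/clos_rt1n_rt/IH.1.
by exists (fun n => iter n f k); split=> // n; apply: (fP _ (inv n)).1.
Qed.

Lemma valid_totalE (phi psi : formula V) c :
  valid_total phi c psi <->
  forall sg, sat phi sg -> must (sat psi) (Run c sg).
Proof.
split=> H sg /H; first by case; exact: not_diverges_must.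
by move=> m; split; [exact: must_not_diverges m|move=> k; exact: must_normal_form m].
Qed.

(** Counterpart of [wp (Seq c1 c2)] as a composition. Both inductions follow the run of [c1] until
    it hands over to [c2]; a fault of [c1] propagates, so it is impossible on either side. *)
Lemma must_seq Q c1 c2 sg :
  must Q (Run (Seq c1 c2) sg) <-> must (fun tau => must Q (Run c2 tau)) (Run c1 sg).
Proof.
split; move eqk: (Run _ _) => k m.
  elim: m c1 sg eqk => // c sg' mk IH c1 sg [? ?]; subst c sg'.
  apply: must_run => -[c1' sg'|tau|] st.
  - exact: IH (step_seq_run _ st) _ _ erefl.
  - exact/must_term/mk/step_seq_term.
  - by have /must_fault := mk _ (step_seq_fault _ st).
elim: m c1 sg eqk => // c sg' mk IH c1 sg [? ?]; subst c sg'.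
apply: must_run => k' st; inversion st; subst.
- by apply: IH; eauto.
- by apply: (must_termE (fun tau => must Q (Run c2 tau)) _).1; apply: mk.
- by have /must_fault : must (fun tau => must Q (Run c2 tau)) (Fault V R) by apply: mk.
Qed.

(** With [must_while_false], shows that [must] of a loop is a fixed point of the loop functional. *)
Lemma must_while_true Q b c s h : beval s b ->
  must Q (Run (While b c) (s, h)) <->
  must (fun tau => must Q (Run (While b c) tau)) (Run c (s, h)).
Proof.
move=> hb; rewrite -must_seq must_runE; split=> [|m k st].
  by apply; apply: step_while_true.
by inversion st; subst=> //; rewrite hb in H4.
Qed.

Lemma must_while_false Q b c s h : ~~ beval s b ->
  must Q (Run (While b c) (s, h)) <-> Q (s, h).
Proof.
move=> hb; rewrite must_runE -must_termE; split=> [|m k st].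
  by apply; apply: step_while_false.
by inversion st; subst=> //; rewrite H4 in hb.
Qed.

(** The derivation of [must] is well-founded even where infinitely branching allocation leaves the
    number of iterations unbounded, so induction on it gives leastness of the fixed point. *)
Lemma must_while_least Q T b c :
  (forall s h, ~~ beval s b -> Q (s, h) -> T (s, h)) ->
  (forall s h, beval s b -> must T (Run c (s, h)) -> T (s, h)) ->
  forall sg, must Q (Run (While b c) sg) -> T sg.
Proof.
move=> Texit Tloop.
(* Between two visits to the loop head the configuration is a partially run body followed by the
   loop, so both shapes enter the induction. *)
suff gen k : must Q k ->
    (forall sg, k = Run (While b c) sg -> T sg) /\
    (forall c' sg, k = Run (Seq c' (While b c)) sg -> must T (Run c' sg)).
  by move=> sg /gen[+ _]; apply.
elim=> [//|c0 sg0 mk IH]; split=> [[s h] [? ?]|c' sg [? ?]]; subst c0 sg0.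
  case: (boolP (beval s b)) => hb.
    by apply: Tloop => //; apply: (IH _ (step_while_true _ _ hb)).2.
  by apply: Texit => //; apply/must_termE/mk/step_while_false.
apply: must_run => -[c1' sg'|tau|] st.
- exact: (IH _ (step_seq_run _ st)).2.
- exact/must_term/(IH _ (step_seq_term _ st)).1.
- by have /must_fault := mk _ (step_seq_fault _ st).
Qed.

(** [Q] varies in the induction, since sequencing and loops use the hypothesis at other
    postconditions. For the heap commands [must] unfolds for one step and matches the
    characterizations of star and wand above. *)
Lemma wp_ind c Q : nonprobabilistic c ->
  wp c (ind R Q) = ind R (fun sg => must Q (Run c sg)).
Proof.
elim: c Q => [|x e|c1 IH1 c2 IH2|b c1 IH1 c2 IH2|b c1 IH1|//|x es|e e'|x e|e] Q.
- move=> _; apply: ind_eq => -[s h] /=; rewrite must_runE -must_termE.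
  by split=> [m k st|]; [inversion st|apply; constructor].
- move=> _; apply: (@ind_eq V R (fun sg => Q (upd sg.1 x (aeval sg.1 e), sg.2))) => -[s h] /=.
  rewrite must_runE -must_termE.
  by split=> [m k st|]; [inversion st|apply; constructor].
- by case/andP=> n1 n2; rewrite /= IH2 // IH1 //; apply: ind_eq => sg; rewrite must_seq.
- case/andP=> n1 n2 /=; apply/funext => -[s h]; rewrite IH1 // IH2 //=.
  case: (boolP (beval s b)) => hb; rewrite !(mul1r, mul0r, addr0, add0r).
  + congr (nat_of_bool _)%:R; apply: asbool_equiv_eq; rewrite [X in _ <-> X]must_runE.
    split=> [m k st|]; last by apply; apply: step_if_true.
    by inversion st; subst=> //; rewrite hb in H5.
  + congr (nat_of_bool _)%:R; apply: asbool_equiv_eq; rewrite [X in _ <-> X]must_runE.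
    split=> [m k st|]; last by apply; apply: step_if_false.
    by inversion st; subst=> //; rewrite H5 in hb.
- move=> n1; have bQ := @ind_bounded V R Q.
  have [bZ ZE Zle] := wp_while_is_lfp b c1 bQ; move: bZ ZE Zle.
  set Z := wp _ _ => bZ ZE Zle.
  pose W sg := must Q (Run (While b c1) sg).
  (* [W] is a fixed point, so [Z] lies below it by leastness of [Z]; the converse is leastness of
     [must]. *)
  suff [ZW WZ] : exple Z (ind R W) /\ exple (ind R W) Z.
    by apply/funext => sg; apply/eqP; rewrite eq_le ZW WZ.
  split.
    apply: Zle; first exact: ind_bounded.
    apply/funext => -[s h]; rewrite IH1 //=.
    case: (boolP (beval s b)) => hb; rewrite !(mul1r, mul0r, addr0, add0r).
      by congr (nat_of_bool _)%:R; apply: asbool_equiv_eq; rewrite /W must_while_true.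
    by congr (nat_of_bool _)%:R; apply: asbool_equiv_eq; rewrite /W must_while_false.
  (* [Z] need not be an indicator a priori; its level set [Z >= 1] is still
     closed under unfolding the loop. *)
  pose T sg : Prop := 1 <= Z sg.
  have TZ : exple (ind R T) Z by apply/ind_exple.
  apply/ind_exple => //; apply: (must_while_least (T := T)) => s h hb.
    by move=> q; rewrite /T -ZE /= (negbTE hb) mul1r mul0r addr0 ind_true.
  move=> m; rewrite /T -ZE /= hb mul1r mul0r add0r.
  have [_ le_wp] := wp_bounded_le c1.
  (* Monotonicity replaces [Z] by the smaller indicator of [T], to which the induction hypothesis
     applies. *)
  apply: le_trans (le_wp _ _ (@ind_bounded V R T) bZ TZ _).
  by rewrite IH1 // ind_true.
- move=> _; apply/funext => -[s h] /=.
  (* At each address the wand is an indicator, so the outer infimum becomes a universal quantifier,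
     matching the demonic choice of a fresh address. *)
  rewrite (inf01_ind (A := fun v : addr => forall h' : heap, hdisj h h' ->
      points_to (EConst V (addr_val v)%:Z) es (s, h') ->
      Q (upd s x (addr_val v)%:Z, hunion h h'))); last first.
    by move=> v _; rewrite -[esubst _ _ _]/(ind R _) ewand_ind.
  congr (nat_of_bool _)%:R; apply: asbool_equiv_eq; rewrite must_runE.
  split=> [m k st|m u fr].
    inversion st; subst; apply: must_term.
    apply: (@wand_points_toP V (EConst V (addr_val u)%:Z) es s h u
      (fun h1 => Q (upd s x (addr_val u)%:Z, h1)) erefl).1 => //.
    exact: m.
  apply/(@wand_points_toP V (EConst V (addr_val u)%:Z) es s h u
      (fun h1 => Q (upd s x (addr_val u)%:Z, h1)) erefl) => _.
  by apply/must_termE/m/step_new.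
- move=> _; rewrite /= ewand_ind estar_ind; apply: ind_eq => -[s h] /=.
  rewrite (star_points_to_anyP e s h (fun h2 => forall h' : heap, hdisj h2 h' ->
    points_to e [:: e'] (s, h') -> Q (s, hunion h2 h'))) must_runE.
  (* Removing the cell and adjoining it again with the new value amounts to overwriting it;
     freshness holds because [a] has just been removed. *)
  have wandE a : addr_of_int (aeval s e) = Some a ->
      (forall h' : heap, hdisj h.[~ a]%fmap h' -> points_to e [:: e'] (s, h') ->
        Q (s, hunion h.[~ a]%fmap h')) <-> Q (s, h.[a <- aeval s e']%fmap).
    move/addr_of_intP => ea.
    rewrite (wand_points_toP [:: e'] h.[~ a]%fmap (fun h' => Q (s, h')) ea) /=.
    rewrite stores1 setf_rem1; split=> // q; apply: q => -[|//] _.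
    rewrite (_ : shift a 0 = a) ?mem_remfF //.
    by apply: val_inj => /=; rewrite addn0.
  split=> [[a [ea ah /(wandE _ ea) q]] k st|m].
    inversion st; subst; first by move: H4; rewrite ea => -[<-]; apply: must_term.
    by have := (lookup_memP h ea).2 ah.
  case E: (lookup h (aeval s e)) => [v|].
    have [a ea ha] := (lookup_someP _ _ _).1 E.
    have ah : a \in domf h by rewrite -fndSome ha.
    by exists a; split=> //; apply/(wandE _ ea)/must_termE/m/step_store.
  by have /must_fault := m _ (step_store_fault _ _ E).
- move=> _ /=.
  (* At most one [v], the content of the cell, gives a nonzero term in the supremum. *)
  rewrite (_ : (fun v => _) = fun v => ind R (fun sg =>
    lookup sg.2 (aeval sg.1 e) = Some v /\ Q (upd sg.1 x v, sg.2))); last first.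
    apply/funext => v; rewrite -[esubst _ _ _]/(ind R _) ewand_ind estar_ind.
    apply: ind_eq => -[s h].
    exact: (star_wand_points_toP e s h v (fun h' => Q (upd s x v, h'))).
  rewrite esup_ind; apply: ind_eq => -[s h] /=; rewrite must_runE.
  split=> [[v [E q]] k st|m].
    by inversion st; subst; move: H4; rewrite E // => -[<-]; apply: must_term.
  case E: (lookup h (aeval s e)) => [v|].
    by exists v; split=> //; apply/must_termE/m/step_fetch.
  by have /must_fault := m _ (step_fetch_fault _ _ E).
- move=> _; rewrite /= estar_ind; apply: ind_eq => -[s h] /=.
  rewrite (star_points_to_anyP e s h (fun h2 => Q (s, h2))) must_runE.
  split=> [[a [ea ah q]] k st|m].
    inversion st; subst; first by move: H3; rewrite ea => -[<-]; apply: must_term.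
    by have := (lookup_memP h ea).2 ah.
  case E: (lookup h (aeval s e)) => [v|].
    have [a ea ha] := (lookup_someP _ _ _).1 E.
    have ah : a \in domf h by rewrite -fndSome ha.
    by exists a; split=> //; apply/must_termE/m/step_free.
  by have /must_fault := m _ (step_free_fault _ E).
Qed.

End MustTerminate.

Theorem theorem4p6 (R : realType) (V : eqType) (c : prog V R)
    (hc : nonprobabilistic c) (phi psi : formula V) :
  valid_total phi c psi <-> exple (embed R phi) (wp c (embed R psi)).
Proof.
rewrite valid_totalE !embed_ind wp_ind // ind_exple; last exact: ind_bounded.
by split=> H sg /H; rewrite ind_ge1.
Qed.
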